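(* Let $(\Omega,\mathcal{A})$ be a measurable space, let $\mathcal{P}=\mathcal{P}(\Omega,\mathcal{A})$ be the convex set of probability measures on $(\Omega,\mathcal{A})$, and let $\lambda,\mu\in\mathcal{P}$. The following assertions are equivalent. 1) The measure $\lambda$ lies in the face $F_{\mathcal{P}}(\mu)$ of $\mathcal{P}$ generated by $\mu$. 2) There is $c\in[1,\infty)$ such that $\lambda(A)\leq c\,\mu(A)$ holds for all $A\in\mathcal{A}$. 3) We have $\lambda\ll\mu$ and there is $c\in[1,\infty)$ such that the Radon-Nikodym derivative satisfies $\frac{\mathrm{d}\lambda}{\mathrm{d}\mu}\leq c$ $\mu$-almost surely.
   Context: $\mathcal{P}$ is regarded as a convex subset of the real vector space of finite signed measures on $(\Omega,\mathcal{A})$. For a convex subset $K$ of a real vector space, with $(x,y)=\{(1-\lambda)x+\lambda y:\lambda\in(0,1)\}$ and $[x,y]=\{(1-\lambda)x+\lambda y:\lambda\in[0,1]\}$, an extreme set of $K$ is a subset $E\subset K$ such that $[x,y]\subset E$ for all points $x\neq y$ in $K$ with $(x,y)\cap E\neq\emptyset$. A face of $K$ is a convex extreme set of $K$. For $x\in K$, the face $F_K(x)$ of $K$ generated by $x$ is the intersection of all faces of $K$ containing $x$; it is the smallest face containing $x$. The notation $\lambda\ll\mu$ means that $\lambda$ is absolutely continuous with respect to $\mu$ (every $\mu$-null set is a $\lambda$-null set), and $\frac{\mathrm{d}\lambda}{\mathrm{d}\mu}:\Omega\to[0,\infty)$ is the Radon-Nikodym derivative. *)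

(* Defs.v *)
From HB Require Import structures.
From mathcomp Require Import all_boot all_order all_algebra.
From mathcomp Require Import all_classical all_reals all_analysis.

Set Implicit Arguments.
Unset Strict Implicit.
Unset Printing Implicit Defensive.

Import Order.TTheory GRing.Theory Num.Theory.
Import numFieldNormedType.Exports.

Local Open Scope classical_set_scope.
Local Open Scope ring_scope.

Section faces.
Context {R : realType} {V : lmodType R}.
Implicit Types (K E F : set V) (x y : V).

Definition open_segment x y : set V :=
  [set (1 - t) *: x + t *: y | t in `]0, 1[%classic].

Definition closed_segment x y : set V :=
  [set (1 - t) *: x + t *: y | t in `[0, 1]%classic].

Definition extreme_set K E : Prop :=
  E `<=` K /\
  forall x y, K x -> K y -> x <> y ->
    open_segment x y `&` E !=set0 -> closed_segment x y `<=` E.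

Definition face K F : Prop := convex_set F /\ extreme_set K F.

Definition generated_face K x : set V :=
  \bigcap_(F in [set F | face K F /\ F x]) F.

End faces.

(* A library charge is defined on all subsets of T, with arbitrary values on
   the non-measurable ones. Finite signed measures are therefore taken to be
   the restrictions of charges to the sigma-algebra, so that equality in the
   vector space below only involves measurable sets. *)
Section signed_measures.
Context {d : measure_display} {T : measurableType d} {R : realType}.

Definition sigma_algebra_type : Type := {A : set T | measurable A}.

Definition is_signed_measure (f : sigma_algebra_type -> R^o) : Prop :=
  exists nu : {charge set T -> \bar R},
    forall A : sigma_algebra_type, nu (sval A) = (f A)%:E.

Definition signed_measure_pred : {pred sigma_algebra_type -> R^o} :=
  fun f => `[< is_signed_measure f >].

Lemma signed_measure_submod_closed : submod_closed signed_measure_pred.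
Proof.
split; first by apply/asboolP; exists czero.
move=> a f g /asboolP[nu nuf] /asboolP[xi xig]; apply/asboolP.
exists (cadd (cscale a nu) xi) => A.
by rewrite -[LHS]/(a%:E * nu (sval A) + xi (sval A))%E nuf xig.
Qed.

HB.instance Definition _ := GRing.isSubmodClosed.Build R
  (sigma_algebra_type -> R^o) signed_measure_pred signed_measure_submod_closed.

End signed_measures.
Arguments sigma_algebra_type {d} T.

Record signed_measure d (T : measurableType d) (R : realType) := SignedMeasure {
  signed_measure_val :> sigma_algebra_type T -> R^o ;
  signed_measure_valP : signed_measure_val \in signed_measure_pred }.

Section signed_measure_lmodType.
Context {d : measure_display} {T : measurableType d} {R : realType}.

HB.instance Definition _ := [isSub for @signed_measure_val d T R].
HB.instance Definition _ := [Choice of signed_measure T R by <:].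
HB.instance Definition _ :=
  [SubChoice_isSubLmodule of signed_measure T R by <:].

End signed_measure_lmodType.

Section probabilities.
Context {d : measure_display} {T : measurableType d} {R : realType}.
Implicit Types P : probability T R.

Lemma probability_is_signed_measure P :
  (fun A : sigma_algebra_type T => fine (P (sval A)) : R^o)
    \in signed_measure_pred.
Proof.
apply/asboolP; exists (charge_of_finite_measure P) => -[A mA] /=.
by rewrite fineK// fin_num_measure.
Qed.

Definition signed_of_probability P : signed_measure T R :=
  SignedMeasure (probability_is_signed_measure P).

Definition probabilities : set (signed_measure T R) :=
  range signed_of_probability.

Lemma probabilities_convex : convex_set probabilities.
Proof.
move=> x y t /set_mem[P _ <-] /set_mem[Q _ <-]; apply/mem_set.
have t0 : 0 <= t%:num by [].
have t1 : 0 <= 1 - t%:num by rewrite subr_ge0.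
pose m := measure_add (mscale (NngNum t0) P) (mscale (NngNum t1) Q).
have mE A : m A = (t%:num%:E * P A + (1 - t%:num)%:E * Q A)%E.
  exact: measure_addE.
have mT : m [set: T] = 1%E.
  by rewrite mE !probability_setT !mule1 -EFinD addrC subrK.
pose P' : probability T R := HB.pack m (Measure.on m)
  (Measure_isProbability.Build _ _ _ m mT).
exists P' => //; apply/val_inj/funext => -[A mA] /=.
rewrite -[RHS]/(t%:num * fine (P A) + (1 - t%:num) * fine (Q A)) [X in fine X]mE.
by rewrite fineD ?fineM// ?fin_numM// ?fin_num_measure.
Qed.

End probabilities.
Arguments probabilities {d} T R.

(* Main.v *)
From HB Require Import structures.
Require Import Defs.
From mathcomp Require Import all_boot all_order all_algebra.
From mathcomp Require Import all_classical all_reals all_analysis.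
From mathcomp Require Import measurable_realfun ring.

(** The probability measures bounded by some multiple of [mu] form a face: if a
    point of an open segment is at most [c mu], then each end point, weighted by
    its coefficient, is at most [c mu] too. Conversely, if [lambda <= c mu] with
    [c > 1], then [nu = (c mu - lambda) / (c - 1)] is a probability measure and
    [mu] lies in the open segment between [nu] and [lambda], so that every face
    containing [mu] contains [lambda]. *)

Set Implicit Arguments.
Unset Strict Implicit.
Unset Printing Implicit Defensive.

Import Order.TTheory GRing.Theory Num.Theory.

Local Open Scope classical_set_scope.
Local Open Scope ring_scope.

Section dominated_probabilities.
Context {d : measure_display} {T : measurableType d} {R : realType}.
Implicit Types (x y v m : signed_measure T R) (A : sigma_algebra_type T).

Lemma signed_measure_combE (s t : R) x y A :
  (s *: x + t *: y) A = s * x A + t * y A.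
Proof. by []. Qed.

(** For the converse, a charge [nu] restricting to [v] may take negative values on non-measurable
    sets. [crestr0] sends those sets to 0, so it is nonnegative everywhere and yields a measure that
    agrees with [v] on the sigma-algebra. *)
Lemma probabilitiesP v : probabilities T R v <->
  (forall A, 0 <= v A) /\ v (exist _ [set: T] measurableT) = 1.
Proof.
split=> [[P _ <-]|[v0 v1]].
  split=> [A|]; first by rewrite fine_ge0.
  by rewrite /= probability_setT.
have /asboolP[nu nuv] := signed_measure_valP v.
have nu_ge0 E : (0 <= crestr0 nu measurableT E)%E.
  rewrite /crestr0; case: ifPn => // /set_mem mE.
  by rewrite /crestr setIT (nuv (exist _ E mE)) lee_fin.
pose m := measure_of_charge (crestr0 nu measurableT) nu_ge0.
have mE A : m (sval A) = (v A)%:E.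
  rewrite -nuv /m /measure_of_charge /crestr0 mem_set ?/crestr ?setIT//.
  exact: svalP.
have mT : m [set: T] = 1%E.
  by rewrite (mE (exist _ _ measurableT)) v1.
pose P : probability T R := HB.pack m (Measure.on m)
  (Measure_isProbability.Build _ _ _ m mT).
exists P => //; apply/val_inj/funext => A /=.
by rewrite [X in fine X]mE.
Qed.

Definition dominated_probabilities m : set (signed_measure T R) :=
  [set v | probabilities T R v /\ exists c : R, forall A, v A <= c * m A].

Lemma dominated_probabilities_comb m (s t : R) x y : 0 <= s -> 0 <= t ->
  s + t = 1 -> dominated_probabilities m x -> dominated_probabilities m y ->
  dominated_probabilities m (s *: x + t *: y).
Proof.
move=> s0 t0 st [/probabilitiesP[x0 x1] [a xa]] [/probabilitiesP[y0 y1] [b yb]].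
split.
  apply/probabilitiesP; split=> [A|]; rewrite signed_measure_combE.
    by rewrite addr_ge0 ?mulr_ge0.
  by rewrite x1 y1 !mulr1.
exists (s * a + t * b) => A; rewrite signed_measure_combE mulrDl -!mulrA.
by rewrite lerD ?ler_wpM2l.
Qed.

Lemma dominated_probabilities_face m :
  face (probabilities T R) (dominated_probabilities m).
Proof.
split.
  move=> x y t /set_mem Ex /set_mem Ey; apply/mem_set.
  apply: dominated_probabilities_comb => //.
    by rewrite /= subr_ge0.
  by rewrite /= addrC subrK.
split=> [v []//|x y Px Py _ [_ [[t + <-] [_ [c zc]]]]].
rewrite /= in_itv /= => /andP[t0 t1].
have [/probabilitiesP[x0 _] /probabilitiesP[y0 _]] := (Px, Py).
have s0 : 0 < 1 - t by rewrite subr_gt0.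
(* Dropping the nonnegative term [t *: y] leaves [(1 - t) * x A <= c * m A], and [t < 1] permits the
   division. The bound for [y] is symmetric, with [0 < t]. *)
have Ex : dominated_probabilities m x.
  split=> //; exists ((1 - t)^-1 * c) => A.
  rewrite -mulrA ler_pdivlMl//; apply: le_trans (zc A).
  by rewrite signed_measure_combE lerDl mulr_ge0// ltW.
have Ey : dominated_probabilities m y.
  split=> //; exists (t^-1 * c) => A.
  rewrite -mulrA ler_pdivlMl//; apply: le_trans (zc A).
  by rewrite signed_measure_combE lerDr mulr_ge0// ltW.
move=> _ [u + <-]; rewrite /= in_itv /= => /andP[u0 u1].
by apply: dominated_probabilities_comb => //; rewrite ?subr_ge0// subrK.
Qed.

Lemma dominated_probabilities_sub_generated_face m : probabilities T R m ->
  dominated_probabilities m `<=` generated_face (probabilities T R) m.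
Proof.
move=> Pm l [Pl [b lb]] F [[Fconv [FP Fext]] Fm].
have [/probabilitiesP[m0 m1] /probabilitiesP[l0 l1]] := (Pm, Pl).
(* Enlarging [b] keeps the bound since [m] is nonnegative; [c > 1] gives [c - 1 > 0] and puts [c^-1]
   in the open unit interval. *)
pose c := Num.max b 2.
have c1 : 1 < c by rewrite /c lt_max (@ltr_nat _ 1 2) orbT.
have lc A : l A <= c * m A.
  by apply: le_trans (lb A) _; rewrite ler_wpM2r// /c le_max lexx.
have c10 : c - 1 != 0 by rewrite subr_eq0 gt_eqF.
have c0 : c != 0 by rewrite gt_eqF// (lt_trans _ c1).
(* This is the solution [n] of [m = (1 - c^-1) *: n + c^-1 *: l]. *)
pose n : signed_measure T R := (c / (c - 1)) *: m + (- (c - 1)^-1) *: l.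
have mE : (1 - c^-1) *: n + c^-1 *: l = m.
  apply/val_inj/funext => A.
  rewrite -[LHS]/(((1 - c^-1) *: n + c^-1 *: l) A) !signed_measure_combE.
  by rewrite -[RHS]/(m A); field; apply/andP.
have Pn : probabilities T R n.
  apply/probabilitiesP; split=> [A|]; rewrite signed_measure_combE.
    rewrite mulrAC mulNr mulrC -mulrBr mulr_ge0// ?subr_ge0//.
    by rewrite invr_ge0 subr_ge0 ltW.
  by rewrite m1 l1; field.
(* Extremeness speaks of distinct end points only; if [n = l], then [l = m], which lies in [F]. *)
have [nl|/eqP nl] := eqVneq n l.
  by move: mE; rewrite nl -scalerDl subrK scale1r => ->.
apply: (Fext n l Pn Pl nl).
  exists m; split=> //; exists c^-1 => //=.
  by rewrite in_itv /= invr_gt0 (lt_trans _ c1)//= invf_lt1// (lt_trans _ c1).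
exists 1; first by rewrite /= in_itv /= ler01 lexx.
by rewrite subrr scale0r add0r scale1r.
Qed.

Lemma generated_face_probabilities m : probabilities T R m ->
  generated_face (probabilities T R) m = dominated_probabilities m.
Proof.
move=> Pm; apply/seteqP; split=> [l|].
  apply; split; first exact: dominated_probabilities_face.
  by split=> //; exists 1 => A; rewrite mul1r.
exact: dominated_probabilities_sub_generated_face.
Qed.

Lemma dominated_probabilities_probabilityP (lambda mu : probability T R) :
  dominated_probabilities (signed_of_probability mu)
    (signed_of_probability lambda) <->
  exists2 c : R, 1 <= c &
    forall A : set T, measurable A -> (lambda A <= c%:E * mu A)%E.
Proof.
split=> [[_ [c lc]]|[c _ lc]]; last first.
  split; first by exists lambda.
  exists c => -[A mA] /=; rewrite -lee_fin EFinM !fineK ?fin_num_measure//.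
  exact: lc.
(* Raising the constant to at least 1 preserves the bound because [mu] is nonnegative. *)
exists (Num.max c 1); first by rewrite le_max lexx orbT.
move=> A mA; have := lc (exist _ A mA); rewrite /= -lee_fin EFinM.
rewrite !fineK ?fin_num_measure// => /le_trans; apply.
by rewrite lee_wpmul2r// lee_fin le_max lexx.
Qed.

End dominated_probabilities.

Section Radon_Nikodym_bound.
Context {d : measure_display} {T : measurableType d} {R : realType}.
Variables lambda mu : {finite_measure set T -> \bar R}.
Local Open Scope ereal_scope.
Local Notation f := (Radon_Nikodym_SigmaFinite.f lambda mu).

Lemma null_dominates_le (c : \bar R) :
  (forall A, measurable A -> lambda A <= c * mu A) -> lambda `<< mu.
Proof.
move=> lc; apply/null_content_dominatesP => A mA muA0; apply/eqP.
by rewrite -measure_le0; have := lc A mA; rewrite muA0 mule0.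
Qed.

(** On [N = {f > c}] the integral of [f - c] is [lambda N - c * mu N <= 0], although the integrand
    is positive there; hence [N] is [mu]-null. Finiteness of [mu] makes the constant integrable, so
    that the integral of the difference splits. *)
Lemma Radon_Nikodym_ae_le (c : R) :
  (forall A, measurable A -> lambda A <= c%:E * mu A) ->
  {ae mu, forall x, f x <= c%:E}.
Proof.
move=> lc; have lm := null_dominates_le lc.
have intf := Radon_Nikodym_SigmaFinite.f_integrable lm.
have mf := measurable_int _ intf.
pose N := f @^-1` `]c%:E, +oo[%classic.
have mN : measurable N.
  by rewrite -[N]setTI; apply: mf => //; exact: emeasurable_itv.
have Ngt x : N x -> c%:E < f x by rewrite /N /= in_itv /= andbT.
have intc : mu.-integrable N (cst c%:E) by exact: finite_measure_integrable_cst.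
have intfN : mu.-integrable N f by exact: integrableS intf.
have int0 : \int[mu]_(x in N) `|f x - c%:E| = 0.
  transitivity (\int[mu]_(x in N) (f x - c%:E)).
    apply: eq_integral => x /set_mem /Ngt /ltW cf.
    by rewrite gee0_abs// sube_ge0.
  apply/eqP; rewrite eq_le; apply/andP; split.
    rewrite integralB// -Radon_Nikodym_SigmaFinite.f_integral// integral_cst//.
    by rewrite sube_le0 lc.
  by apply: integral_ge0 => x /Ngt /ltW cf; rewrite sube_ge0.
have mfc : measurable_fun N (fun x => f x - c%:E).
  by apply: emeasurable_funB => //; exact: measurable_funS mf.
(* The vanishing integral gives [f = c] almost everywhere on [N], against the strict inequality that
   defines [N]. *)
have := (ae_eq_integral_abs mu mN mfc).1 int0.
apply: filterS => x fc0; rewrite leNgt; apply/negP => cf.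
have /fc0 /eqP : N x by rewrite /N /= in_itv /= andbT.
by rewrite gt_eqF// sube_gt0.
Qed.

(** Integrating [f <= c] over [A] gives the bound, as [lambda A] is the integral of [f] over [A].
    Monotonicity is used in its form for nonnegative functions, whence [0 <= c]. *)
Lemma Radon_Nikodym_ae_le_measure (c : R) : (0 <= c)%R -> lambda `<< mu ->
  {ae mu, forall x, f x <= c%:E} ->
  forall A, measurable A -> lambda A <= c%:E * mu A.
Proof.
move=> c0 lm fc A mA.
have mf := measurable_int _ (Radon_Nikodym_SigmaFinite.f_integrable lm).
rewrite (Radon_Nikodym_SigmaFinite.f_integral lm)// -integral_cst//.
apply: ae_ge0_le_integral => //.
- by move=> x _; exact: Radon_Nikodym_SigmaFinite.f_ge0.
- exact: measurable_funS mf.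
- by apply: filterS fc.
Qed.

End Radon_Nikodym_bound.

Local Open Scope ereal_scope.

Theorem theorem9p2 (R : realType) (d : measure_display) (T : measurableType d)
    (lambda mu : probability T R) :
  [<-> generated_face (probabilities T R) (signed_of_probability mu)
         (signed_of_probability lambda);
       exists2 c : R, (1 <= c)%R &
         forall A : set T, measurable A -> lambda A <= c%:E * mu A;
       lambda `<< mu /\
       exists2 c : R, (1 <= c)%R &
         {ae mu, forall x, Radon_Nikodym_SigmaFinite.f lambda mu x <= c%:E}].
Proof.
have Pmu : probabilities T R (signed_of_probability mu) by exists mu.
rewrite (generated_face_probabilities Pmu).
tfae.
- by move/dominated_probabilities_probabilityP.
- move=> [c c1 lc]; split; first exact: null_dominates_le lc.
  by exists c => //; exact: Radon_Nikodym_ae_le.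
(* The cycle closes through the setwise bound, which is equivalent to membership in the face. *)
- move=> [lm [c c1 fc]]; apply/dominated_probabilities_probabilityP.
  exists c => //; apply: Radon_Nikodym_ae_le_measure => //.
  exact: le_trans c1.
Qed.
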